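(* Let $G$ and $H$ be real Hilbert spaces, let $S$ be the unit sphere of $G$, and let $L, C\colon G\to H$ be bounded linear operators. Assume that $x_*\in S$ and $\lambda_*\in\mathbb{R}$ with $Lx_*=\lambda_*Cx_*$ are such that $(x_*,0,\lambda_* )$ is a simple solution. Then the map $$\Psi\colon S\times\mathbb{R}\to H,\qquad (x,\lambda)\mapsto Lx-\lambda Cx,$$ sends, diffeomorphically, a neighborhood of $(x_*,\lambda_* )$ in $S\times\mathbb{R}$ onto a neighborhood of the origin $0\in H$.
   Context: The underlying problem is $Lx+\varepsilon N(x)=\lambda Cx$, $x\in S$, with $\varepsilon,\lambda\in\mathbb{R}$ and $N\colon S\to H$ continuous. Its solutions are triples $(x,\varepsilon,\lambda)$; those with $\varepsilon=0$ are called trivial (they do not depend on $N$). A trivial solution $(x_*,0,\lambda_* )$ is called simple if the operator $A=L-\lambda_*C$ satisfies: (1) $\operatorname{Ker}A=\mathbb{R}x_*$; (2) $Cx_*\neq 0$; (3) $\operatorname{Im}A\oplus C(\operatorname{Ker}A)=H$. Smooth means $C^\infty$. The sphere $S$ is regarded as a smooth ($1$-codimensional) submanifold of $G$ and $S\times\mathbb{R}$ as a smooth submanifold of the Hilbert space $G\times\mathbb{R}$. A diffeomorphism is a smooth bijection with smooth inverse. *)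

(* Defs.v *)
From HB Require Import structures.
From mathcomp Require Import all_boot all_order all_algebra.
From mathcomp Require Import all_classical all_reals all_analysis.

Set Implicit Arguments.
Unset Strict Implicit.
Unset Printing Implicit Defensive.

Import Order.TTheory GRing.Theory Num.Def Num.Theory.
Import numFieldNormedType.Exports.

Local Open Scope classical_set_scope.
Local Open Scope ring_scope.

HB.mixin Record NormedModule_isHilbert (R : realType) V
    of CompleteNormedModule R V := {
  inner : {dot V for (@idfun R)} ;
  sqr_normE : forall x : V, `|x| ^+ 2 = inner x x
}.

#[short(type="hilbertType")]
HB.structure Definition Hilbert (R : realType) :=
  {V of CompleteNormedModule R V & NormedModule_isHilbert R V}.

(* For a linear map, boundedness and continuity coincide
   ([linear_bounded_continuous]). *)
Definition bounded_linear (R : realType) (E F : normedModType R) :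
    {pred E -> F} :=
  mem [set f : E -> F | linear f /\ continuous f].

Record boundedOp (R : realType) (E F : normedModType R) := BoundedOp {
  boundedOp_fun :> E -> F ;
  _ : boundedOp_fun \in @bounded_linear R E F
}.

Section BoundedOperators.
Context {R : realType} {E F : normedModType R}.

HB.instance Definition _ := [isSub for @boundedOp_fun R E F].
HB.instance Definition _ := [Choice of boundedOp E F by <:].

Lemma boundedOpP (f : boundedOp E F) : linear f /\ continuous f.
Proof. by case: f => f /= /[!inE]. Qed.

HB.instance Definition _ (f : boundedOp E F) :=
  GRing.isLinear.Build R E F *:%R f (boundedOpP f).1.

Lemma boundedOp_continuous (f : boundedOp E F) : continuous f.
Proof. exact: (boundedOpP f).2. Qed.

Lemma boundedOp_eqP (f g : boundedOp E F) : f =1 g <-> f = g.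
Proof. by split=> [/funext fg|->//]; exact: val_inj. Qed.

Lemma bounded_linear_submod_closed :
  submod_closed (@bounded_linear R E F).
Proof.
split=> [|a f g].
  rewrite inE /=; split; last exact: cst_continuous.
  by move=> a x y; rewrite scaler0 addr0.
rewrite !inE /= => -[fl fc] [gl gc]; split=> [b x y|x].
  change (a *: f (b *: x + y) + g (b *: x + y) =
          b *: (a *: f x + g x) + (a *: f y + g y)).
  by rewrite fl gl !scalerDr !scalerA [a * b]mulrC addrACA.
by apply: cvgD; [apply: cvgZr; exact: fc|exact: gc].
Qed.

HB.instance Definition _ := GRing.isSubmodClosed.Build R (E -> F)
  (@bounded_linear R E F) bounded_linear_submod_closed.
HB.instance Definition _ := [SubChoice_isSubLmodule of boundedOp E F by <:].

Definition opnorm (f : boundedOp E F) : R :=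
  sup [set `|f x| | x in [set x : E | `|x| <= 1]].

Lemma opnorm_has_sup (f : boundedOp E F) :
  has_sup [set `|f x| | x in [set x : E | `|x| <= 1]].
Proof.
split; first by exists `|f 0|; exists 0 => //=; rewrite normr0.
have /linear_boundedP :=
  (linear_bounded_continuous f).2 (@boundedOp_continuous f).
move=> /pinfty_ex_gt0[r r0 fr]; exists r => _ /= [x x1 <-].
by rewrite (le_trans (fr x))// ler_piMr// ltW.
Qed.

Lemma opnorm_ge0 (f : boundedOp E F) : 0 <= opnorm f.
Proof.
apply: (le_trans (normr_ge0 (f 0))); apply: sup_upper_bound.
  exact: opnorm_has_sup.
by exists 0 => //=; rewrite normr0.
Qed.

Lemma ler_opnorm (f : boundedOp E F) x : `|f x| <= opnorm f * `|x|.
Proof.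
have [->|x0] := eqVneq x 0; first by rewrite linear0 !normr0 mulr0.
have nx : 0 < `|x| by rewrite normr_gt0.
rewrite -ler_pdivrMr//; apply: (sup_upper_bound (opnorm_has_sup f)).
exists (`|x|^-1 *: x) => /=.
  by rewrite normrZ normfV normr_id mulVf// gt_eqF.
by rewrite linearZ/= normrZ normfV normr_id mulrC.
Qed.

Lemma opnorm_le (f : boundedOp E F) (M : R) :
  0 <= M -> (forall x, `|f x| <= M * `|x|) -> opnorm f <= M.
Proof.
move=> M0 fM; apply: ge_sup; first exact: (opnorm_has_sup f).1.
by move=> _ /= [x x1 <-]; rewrite (le_trans (fM x))// ler_piMr.
Qed.

Let opnormD (f g : boundedOp E F) : opnorm (f + g) <= opnorm f + opnorm g.
Proof.
apply: opnorm_le => [|x]; first by rewrite addr_ge0// opnorm_ge0.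
by rewrite mulrDl (le_trans (ler_normD _ _))// lerD// ler_opnorm.
Qed.

Let opnormZ_le (a : R) (f : boundedOp E F) : opnorm (a *: f) <= `|a| * opnorm f.
Proof.
apply: opnorm_le => [|x]; first by rewrite mulr_ge0// opnorm_ge0.
by rewrite normrZ -mulrA ler_wpM2l// ler_opnorm.
Qed.

Let opnormZ (a : R) (f : boundedOp E F) : opnorm (a *: f) = `|a| * opnorm f.
Proof.
have [->|a0] := eqVneq a 0.
  rewrite scale0r normr0 mul0r; apply/eqP; rewrite eq_le opnorm_ge0 andbT.
  by apply: opnorm_le => // x; rewrite /= normr0 mul0r.
apply/eqP; rewrite eq_le opnormZ_le/=.
have := opnormZ_le a^-1 (a *: f); rewrite scalerA mulVf// scale1r normfV.
by rewrite ler_pdivlMl ?normr_gt0.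
Qed.

Let opnorm0_eq0 (f : boundedOp E F) : opnorm f = 0 -> f = 0.
Proof.
move=> f0; apply/boundedOp_eqP => x; apply/eqP.
by rewrite -normr_le0 (le_trans (ler_opnorm f x))// f0 mul0r.
Qed.

HB.instance Definition _ := Lmodule_isNormed.Build R (boundedOp E F)
  opnormD opnormZ opnorm0_eq0.

Lemma opnormE (f : boundedOp E F) : `|f| = opnorm f.
Proof. by []. Qed.

End BoundedOperators.

Fixpoint Ck (R : realType) (n : nat) (E F : normedModType R)
    (U : set E) (f : E -> F) : Prop :=
  if n is m.+1 then
    exists2 Df : E -> boundedOp E F,
      (forall x, U x -> is_diff x f (Df x)) & Ck m U Df
  else forall x, U x -> {for x, continuous f}.

(* Meant for open [U]: [is_diff] is the Frechet derivative in the ambient space. *)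
Definition smooth (R : realType) (E F : normedModType R)
    (U : set E) (f : E -> F) : Prop := forall n, Ck n U f.

(* Smoothness on an arbitrary subset [M], in particular on a submanifold of the
   ambient space [E]: local extendability to a smooth map on an open subset
   of [E].  Only the values of [f] on [M] matter.  A map into a submanifold
   of [F] is smooth when it is smooth as a map into [F]. *)
Definition smooth_on (R : realType) (E F : normedModType R)
    (M : set E) (f : E -> F) : Prop :=
  forall x, M x -> exists (U : set E) (g : E -> F),
    [/\ open U, U x, smooth U g & forall y, (U `&` M) y -> f y = g y].

Definition diffeomorphism (R : realType) (E F : normedModType R)
    (A : set E) (B : set F) (f : E -> F) : Prop :=
  [/\ set_bij A B f, smooth_on A f &
      exists2 g : F -> E, {in A, cancel f g} & smooth_on B g].

Definition unit_sphere (R : realType) (V : normedModType R) : set V :=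
  [set x | `|x| = 1].

Section SimpleSolutions.
Context {R : realType} {G H : hilbertType R}.
Implicit Types (L C : boundedOp G H) (x : G) (lambda : R).

Definition op_ker (A : boundedOp G H) : set G := [set x | A x = 0].

Definition direct_sum (V W : set H) : Prop :=
  V `&` W = [set 0] /\
  [set v + w | v in V & w in W] = [set: H].

(* [(x, 0, lambda)] solves [L x + eps * N x = lambda * C x] on the sphere; the
   term in [N] drops out. *)
Definition trivial_solution L C x lambda : Prop :=
  unit_sphere x /\ L x = lambda *: C x.

Definition simple_solution L C x lambda : Prop :=
  let A := L - lambda *: C in
  [/\ trivial_solution L C x lambda,
      op_ker A = [set a *: x | a in [set: R]],
      C x != 0 &
      direct_sum (range A) (C @` op_ker A)].

Definition Psi L C (p : G * R) : H := L p.1 - p.2 *: C p.1.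

End SimpleSolutions.

(* Main.v *)
Require Import Defs.
From HB Require Import structures.
From mathcomp Require Import all_boot all_order all_algebra.
From mathcomp Require Import all_classical all_reals all_analysis.
From mathcomp Require Import ring lra.
Import Order.TTheory GRing.Theory Num.Theory.
Import numFieldNormedType.Exports.
Local Open Scope classical_set_scope.
Local Open Scope ring_scope.
Set Implicit Arguments.
Unset Strict Implicit.
Unset Printing Implicit Defensive.

(* [Phi (x, l) = (L x - l C x, |x|^2)] is a quadratic map from [G * R] to
   [H * R].  Simplicity makes its differential at the solution bijective, hence
   boundedly invertible by Banach's theorem, and a contraction argument inverts
   [Phi] near that point; the local inverse of [Psi] on the sphere is
   [h |-> Phi^-1 (h, 1)].

   Smoothness avoids the calculus of higher derivatives: if [u] is continuous
   with [Phi (u h)] affine in [h] and the differential of [Phi] at [u h]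
   invertible, then [u] is differentiable, and the pair [(u, Du)] satisfies the
   same hypotheses for the quadratic map [(x, D) |-> (Phi x, dPhi x o D)].
   Hence [u] is [C^n] for all [n], by induction on [n]. *)

(** * Bounded operators from bilinear maps, compositions, projections and pairings *)

Section OperatorConstructions.
Context {R : realType}.
Implicit Types E F : normedModType R.

Lemma bounded_linear_bound E F (f : E -> F) (M : R) :
  linear f -> (forall x, `|f x| <= M * `|x|) -> f \in @bounded_linear R E F.
Proof.
move=> lf fM; rewrite inE; split => //.
pose fl : {linear E -> F} := HB.pack f (GRing.isLinear.Build R E F *:%R f lf).
apply: (linear_bounded_continuous fl).1; apply/linear_boundedP.
near=> r => x; apply: (le_trans (fM x)); rewrite ler_wpM2r//.
Unshelve. all: by end_near. Qed.

Definition mk_op E F (f : E -> F) (M : R) (lf : linear f)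
  (fM : forall x, `|f x| <= M * `|x|) : boundedOp E F :=
  BoundedOp (bounded_linear_bound lf fM).

Lemma opnorm_bound E F (f : boundedOp E F) (M : R) :
  0 <= M -> (forall x, `|f x| <= M * `|x|) -> `|f| <= M.
Proof. exact: opnorm_le. Qed.

Lemma op_bound E F (f : boundedOp E F) x : `|f x| <= `|f| * `|x|.
Proof. exact: ler_opnorm. Qed.

Lemma op_boundW E F (f : boundedOp E F) a x : `|x| <= a -> `|f x| <= `|f| * a.
Proof. by move=> xa; rewrite (le_trans (op_bound _ _))// ler_wpM2l. Qed.

Section Bilinear.
Context {E E' F : normedModType R} (b : E -> E' -> F) (M : R).
Hypothesis b_linl : forall y, linear (b ^~ y).
Hypothesis b_linr : forall x, linear (b x).
Hypothesis bM : forall x y, `|b x y| <= M * `|x| * `|y|.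
Hypothesis M0 : 0 <= M.

Definition bilin_op1 x : boundedOp E' F := mk_op (b_linr x) (bM x).

Lemma bilin_op1_linear : linear bilin_op1.
Proof. by move=> a x y; apply/boundedOp_eqP => z; exact: b_linl. Qed.

Lemma bilin_op1_bound x : `|bilin_op1 x| <= M * `|x|.
Proof. by apply: opnorm_bound => [|y]; [rewrite mulr_ge0|exact: bM]. Qed.

Definition bilin_op : boundedOp E (boundedOp E' F) :=
  mk_op bilin_op1_linear bilin_op1_bound.

End Bilinear.

Section Composition.
Context {E F F' : normedModType R}.

Lemma comp_op_linear (g : boundedOp F F') (f : boundedOp E F) : linear (g \o f).
Proof. by move=> a x y /=; rewrite !linearP. Qed.

Lemma comp_op_le (g : boundedOp F F') (f : boundedOp E F) x :
  `|(g \o f) x| <= `|g| * `|f| * `|x|.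
Proof. by rewrite -mulrA; apply: op_boundW; exact: op_bound. Qed.

Definition comp_op g f : boundedOp E F' :=
  mk_op (comp_op_linear g f) (comp_op_le g f).

Lemma comp_opE g f x : comp_op g f x = g (f x). Proof. by []. Qed.

Lemma comp_op_bound g f : `|comp_op g f| <= `|g| * `|f|.
Proof. by apply: opnorm_bound; [rewrite mulr_ge0|exact: comp_op_le]. Qed.

Lemma comp_op_linl f : linear (comp_op ^~ f).
Proof. by move=> a g h; apply/boundedOp_eqP. Qed.

Lemma comp_op_linr g : linear (comp_op g).
Proof.
by move=> a f h; apply/boundedOp_eqP => x; rewrite /= -[LHS]/(g _) linearP.
Qed.

(** Applied to a fixed [g] it is post-composition with [g], as a bounded operator between operator
    spaces; this lets [g] act on derivatives. *)
Definition comp_bilin :=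
  @bilin_op (boundedOp F F') (boundedOp E F) (boundedOp E F') comp_op 1
  comp_op_linl comp_op_linr
  (fun g f => le_trans (comp_op_bound g f)
     (eq_ind_r (fun c => _ <= c * _) (lexx _) (mul1r _))) ler01.

End Composition.

Section Products.
Context {E F : normedModType R}.

Lemma le_norm_prod (x : E * F) a : `|x| <= a <-> `|x.1| <= a /\ `|x.2| <= a.
Proof. by rewrite prod_normE ge_max; split => /andP. Qed.

Lemma norm_fst_le (x : E * F) : `|x.1| <= `|x|.
Proof. by have [] := (le_norm_prod x `|x|).1 (lexx _). Qed.

Lemma norm_snd_le (x : E * F) : `|x.2| <= `|x|.
Proof. by have [] := (le_norm_prod x `|x|).1 (lexx _). Qed.

End Products.

Definition fst_op E F : boundedOp (E * F)%type E :=
  @mk_op (E * F)%type E fst 1 (fun _ _ _ => erefl)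
   (fun x => eq_ind_r (fun c => _ <= c) (norm_fst_le x) (mul1r _)).

Definition snd_op E F : boundedOp (E * F)%type F :=
  @mk_op (E * F)%type F snd 1 (fun _ _ _ => erefl)
   (fun x => eq_ind_r (fun c => _ <= c) (norm_snd_le x) (mul1r _)).

Section Pairing.
Context {E F F' : normedModType R} (f : boundedOp E F) (g : boundedOp E F').

Lemma pair_op_linear : linear (fun x => (f x, g x)).
Proof. by move=> a x y; rewrite !linearP. Qed.

Lemma pair_op_le x : `|(f x, g x)| <= Num.max `|f| `|g| * `|x|.
Proof.
by apply/le_norm_prod; split => /=; rewrite (le_trans (op_bound _ _))//;
  rewrite ler_wpM2r// le_max lexx ?orbT.
Qed.

Definition pair_op : boundedOp E (F * F')%type :=
  mk_op pair_op_linear pair_op_le.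

End Pairing.

End OperatorConstructions.

(** * Frechet differentiability from a quadratic remainder *)

Section Differentials.
Context {R : realType}.
Implicit Types E F : normedModType R.

Lemma is_diff_quadratic E F (f : E -> F) (D : boundedOp E F) (M : R) x :
  (\forall w \near 0, `|f (x + w) - f x - D w| <= M * `|w| ^+ 2) ->
  is_diff x f D.
Proof.
move=> fD.
have Dc : continuous D := @boundedOp_continuous _ _ _ D.
have fE : f \o shift x = cst (f x) + D +o_ 0 id.
  apply/eqaddoP => _/posnumP[e]; near=> w.
  have -> : (f \o shift x - (cst (f x) + (D : E -> F))) w =
      f (x + w) - f x - D w.
    by rewrite -[LHS]/(f (w + x) - (f x + D w)) [w + x]addrC opprD addrA.
  (* [M] may be zero or negative; [|M| + 1] bounds it by a constant that can be divided by. *)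
  have M0 : 0 < `|M| + 1 by rewrite ltr_wpDl.
  apply: (@le_trans _ _ (M * `|w| ^+ 2)); first by near: w.
  apply: (@le_trans _ _ ((`|M| + 1) * `|w| ^+ 2)).
    by rewrite ler_wpM2r ?exprn_ge0// (le_trans (ler_norm _))// lerDl.
  rewrite expr2 mulrA ler_wpM2r// mulrC -ler_pdivlMr//.
have dE := diff_unique Dc fE.
apply: DiffDef => //; apply/diff_locallyP; rewrite dE; split => //.
Unshelve. all: by end_near. Qed.

End Differentials.

(** * Calculus of quadratic maps *)

Section QuadraticMaps.
Context {R : realType}.
Implicit Types E F : normedModType R.

Lemma scale_half_double E (x : E) : 2^-1 *: (x + x) = x.
Proof. by rewrite scalerDr -scalerDl -div1r -splitr scale1r. Qed.

Lemma op_addE E F (f g : boundedOp E F) x : (f + g) x = f x + g x.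
Proof. by []. Qed.

Lemma opD E F (f : boundedOp E F) x y : f (x + y) = f x + f y.
Proof. exact: linearD. Qed.

Lemma opB E F (f : boundedOp E F) x y : f (x - y) = f x - f y.
Proof. exact: linearB. Qed.

Lemma opN E F (f : boundedOp E F) x : f (- x) = - f x.
Proof. exact: linearN. Qed.

Lemma opZ E F (f : boundedOp E F) a x : f (a *: x) = a *: f x.
Proof. exact: linearZ. Qed.

Lemma op0 E F (f : boundedOp E F) : f 0 = 0.
Proof. exact: linear0. Qed.

Lemma op_appD E E' F (b : boundedOp E (boundedOp E' F)) x y z :
  b (x + y) z = b x z + b y z.
Proof. by rewrite opD. Qed.

(** The factor 1/2 makes the differential, for symmetric [b], equal to [T + b x], which is affine in
    [x]. *)
Definition quad E F (T : boundedOp E F) (b : boundedOp E (boundedOp E F)) x :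
  F := T x + 2^-1 *: b x x.

Definition dquad E F (T : boundedOp E F) (b : boundedOp E (boundedOp E F)) x :
  boundedOp E F := T + b x.

Definition symmetric_op E F (b : boundedOp E (boundedOp E F)) :=
  forall x y, b x y = b y x.

Lemma dquadE E F (T : boundedOp E F) b x w : dquad T b x w = T w + b x w.
Proof. by []. Qed.

Lemma dquadD E F (T : boundedOp E F) b x w :
  dquad T b (x + w) = dquad T b x + b w.
Proof. by rewrite /dquad opD addrA. Qed.

Lemma quadD E F (T : boundedOp E F) b x w : symmetric_op b ->
  quad T b (x + w) = quad T b x + dquad T b x w + 2^-1 *: b w w.
Proof.
move=> bs; rewrite dquadE /quad op_appD !opD (bs w x).
rewrite -!addrA; congr (_ + _); rewrite [RHS]addrCA; congr (_ + _).
rewrite !scalerDr !addrA -(addrA (_ *: b x x)); congr (_ + _ + _).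
by rewrite -scalerDr scale_half_double.
Qed.

Lemma quad0 E F (T : boundedOp E F) x : quad T 0 x = T x.
Proof. by rewrite /quad -[RHS]addr0; congr (_ + _); exact: scaler0. Qed.

Lemma op_bound2 E E' F (b : boundedOp E (boundedOp E' F)) x y :
  `|b x y| <= `|b| * `|x| * `|y|.
Proof. by rewrite (le_trans (op_bound _ _))// ler_wpM2r// op_bound. Qed.

Lemma is_diff_quad E F (T : boundedOp E F) b x : symmetric_op b ->
  is_diff x (quad T b) (dquad T b x).
Proof.
move=> bs; apply: (@is_diff_quadratic _ _ _ _ _ (2^-1 * `|b|)).
apply: nearW => w; rewrite quadD// -(addrA (quad T b x)).
rewrite (addrC (quad T b x)) addrK addrAC subrr add0r.
rewrite normrZ ger0_norm// -mulrA ler_wpM2l// expr2 mulrA.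
exact: op_bound2.
Qed.

Lemma quad_continuous E F (T : boundedOp E F) b : symmetric_op b ->
  continuous (quad T b).
Proof.
by move=> bs x; apply: differentiable_continuous; case: (is_diff_quad T x bs).
Qed.

Lemma symmetric_op0 E F : symmetric_op (0 : boundedOp E (boundedOp E F)).
Proof. by []. Qed.

Lemma is_diff_ext E F (f g : E -> F) D x :
  f =1 g -> is_diff x f D -> is_diff x g D.
Proof. by move=> /funext ->. Qed.

(* Constants are included in the statement because [dquad] is affine. *)
Lemma quad_Ck n E F (c : F) (T : boundedOp E F) b (U : set E) :
  symmetric_op b -> Ck n U (fun x => c + quad T b x).
Proof.
elim: n F c T b => [|n IH] F c T b bs.
  move=> x _; apply: cvgD; first exact: cvg_cst.
  exact: quad_continuous.
exists (dquad T b) => [x _|].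
  have := @is_diffD _ _ _ _ _ _ _ x (is_diff_cst c x) (is_diff_quad T x bs).
  by rewrite add0r.
have -> : dquad T b = fun x => T + quad b 0 x.
  by apply/funext => x; rewrite quad0.
exact: IH.
Qed.

(** The derivative of [P \o f] is post-composition with [P] applied to [Df]: again a bounded
    operator after a map of one class less, so the induction runs over all target spaces. *)
Lemma Ck_comp_op n E F F' (U : set E) (f : E -> F) (P : boundedOp F F') :
  Ck n U f -> Ck n U (P \o f).
Proof.
elim: n F F' f P => [|n IH] F F' f P.
  move=> fc x Ux; apply: continuous_comp; first exact: fc.
  exact: boundedOp_continuous.
move=> [Df fD Df_Ck]; exists (comp_op P \o Df) => [x Ux|].
  have Pd : is_diff (f x) P P.
    have := is_diff_quad P (f x) (@symmetric_op0 F F').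
    rewrite /dquad addr0; apply: is_diff_ext => y.
    exact: quad0.
  exact: is_diff_comp (fD x Ux) Pd.
exact: (IH _ _ _ (comp_bilin P)).
Qed.

End QuadraticMaps.

(** * Smoothness of continuous solutions of quadratic equations *)

Section ImplicitSmoothness.
Context {R : realType}.
Implicit Types E F V : normedModType R.

Definition op_inverse E F (f : boundedOp E F) (g : boundedOp F E) :=
  cancel f g /\ cancel g f.

Section Prolongation.
Context {V E F : normedModType R}.
Variables (T : boundedOp E F) (b : boundedOp E (boundedOp E F)).
Hypothesis b_sym : symmetric_op b.

Local Notation E' := (E * boundedOp V E)%type.
Local Notation F' := (F * boundedOp V F)%type.

Definition prol_lin : boundedOp E' F' :=
  pair_op (comp_op T (fst_op _ _)) (comp_op (comp_bilin T) (snd_op _ _)).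

(** Polar form of the quadratic part of the prolonged map
    [(x, D) |-> (quad T b x, dquad T b x o D)]. The two symmetric terms of the second component
    merge on the diagonal and cancel the 1/2 of [quad]. *)
Definition prol_fun (p q : E') : F' :=
  (b p.1 q.1, comp_op (b p.1) q.2 + comp_op (b q.1) p.2).

Lemma prol_fun_sym p q : prol_fun p q = prol_fun q p.
Proof. by rewrite /prol_fun (b_sym p.1) [X in (_, X)]addrC. Qed.

Lemma prol_fun_linr p : linear (prol_fun p).
Proof.
move=> a q q'; apply/pair_equal_spec; split => /=; first by rewrite opD opZ.
apply/boundedOp_eqP => x; rewrite -[LHS]/(b p.1 (a *: q.2 x + q'.2 x) +
  b (a *: q.1 + q'.1) (p.2 x)).
rewrite opD opZ op_appD opZ -[RHS]/(a *: (b p.1 (q.2 x) + b q.1 (p.2 x)) +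
  (b p.1 (q'.2 x) + b q'.1 (p.2 x))).
by rewrite scalerDr addrACA.
Qed.

Lemma prol_fun_linl q : linear (prol_fun ^~ q).
Proof.
by move=> a p p'; rewrite !(prol_fun_sym _ q) -(prol_fun_linr q).
Qed.

Lemma prol_fun_bound p q : `|prol_fun p q| <= (2 * `|b|) * `|p| * `|q|.
Proof.
have bpq (x : E) (y : boundedOp V E) s t : `|x| <= s -> `|y| <= t ->
    `|comp_op (b x) y| <= `|b| * s * t.
  move=> xs yt; apply: (le_trans (comp_op_bound _ _)).
  by rewrite ler_pM// op_boundW.
apply/le_norm_prod; split => /=.
  apply: (le_trans (op_bound2 _ _ _)).
  rewrite ler_pM ?norm_fst_le// ler_pM ?norm_fst_le//.
  by rewrite ler_peMl// ler1n.
apply: (le_trans (ler_normD _ _)).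
have -> : 2 * `|b| * `|p| * `|q| = `|b| * `|p| * `|q| + `|b| * `|q| * `|p|.
  by rewrite (mulrAC _ `|q|) -mulrDr; ring.
by rewrite lerD ?bpq ?norm_fst_le ?norm_snd_le.
Qed.

Definition prol_bilin : boundedOp E' (boundedOp E' F') :=
  bilin_op prol_fun_linl prol_fun_linr prol_fun_bound
    (mulr_ge0 (ler0n _ 2) (normr_ge0 b)).

Lemma prol_bilin_sym : symmetric_op prol_bilin.
Proof. exact: prol_fun_sym. Qed.

Lemma prol_quadE x (D : boundedOp V E) :
  quad prol_lin prol_bilin (x, D) = (quad T b x, comp_op (dquad T b x) D).
Proof.
apply/pair_equal_spec; split => //=; apply/boundedOp_eqP => v.
rewrite -[LHS]/(T (D v) + 2^-1 *: (b x (D v) + b x (D v))).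
rewrite -[RHS]/(T (D v) + b x (D v)); congr (_ + _).
exact: scale_half_double.
Qed.

Lemma comp_opr_bound F1 F2 (D : boundedOp V F1) (f : boundedOp F1 F2) :
  `|comp_op f D| <= `|D| * `|f|.
Proof. by rewrite mulrC comp_op_bound. Qed.

Definition comp_opr F1 F2 (D : boundedOp V F1) :
    boundedOp (boundedOp F1 F2) (boundedOp V F2) :=
  mk_op (@comp_op_linl _ _ _ F2 D) (comp_opr_bound D).

Lemma prol_dquadE x (D : boundedOp V E) (w : E) (Z : boundedOp V E) :
  dquad prol_lin prol_bilin (x, D) (w, Z) =
  (dquad T b x w, comp_op (dquad T b x) Z + comp_op (b w) D).
Proof.
apply/pair_equal_spec; split => //=; apply/boundedOp_eqP => v.
rewrite -[LHS]/(T (Z v) + (b x (Z v) + b w (D v))).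
by rewrite -[RHS]/(T (Z v) + b x (Z v) + b w (D v)) addrA.
Qed.

(* [dquad] of the prolonged map is block triangular. *)
Lemma prol_dquad_inverse x (D : boundedOp V E) g :
  op_inverse (dquad T b x) g ->
  exists g', op_inverse (dquad prol_lin prol_bilin (x, D)) g'.
Proof.
move=> [gK Kg].
(* Back substitution: [g1] recovers the first unknown, [g2] removes its contribution from the second
   equation, and [g] then solves for the second unknown. *)
pose g1 : boundedOp F' E := comp_op g (fst_op F (boundedOp V F)).
pose g2 : boundedOp F' (boundedOp V F) :=
  snd_op F (boundedOp V F) - comp_op (@comp_opr E F D) (comp_op b g1).
exists (pair_op g1 (comp_op (comp_bilin g) g2)); split.
  move=> [w Z]; rewrite prol_dquadE; apply/pair_equal_spec; split => /=.
    exact: gK.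
  apply/boundedOp_eqP => v.
  rewrite -[LHS]/(g (dquad T b x (Z v) + b w (D v) -
    b (g (dquad T b x w)) (D v))).
  by rewrite (gK w) addrK gK.
move=> [r S]; rewrite -[pair_op _ _ _]/(g r, comp_op g (g2 (r, S))) prol_dquadE.
apply/pair_equal_spec; split; first exact: Kg.
apply/boundedOp_eqP => v.
rewrite -[LHS]/(dquad T b x (g (S v - b (g r) (D v))) + b (g r) (D v)).
by rewrite Kg subrK.
Qed.

End Prolongation.

Section Solution.
Context {V E F : normedModType R}.
Variables (T : boundedOp E F) (b : boundedOp E (boundedOp E F)).
Hypothesis b_sym : symmetric_op b.
Variables (U : set V) (u : V -> E) (c : F) (K : boundedOp V F).
Hypothesis U_open : open U.
Hypothesis u_cont : forall h, U h -> {for h, continuous u}.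
Hypothesis uE : forall h, U h -> quad T b (u h) = c + K h.

Lemma near_addr (P : set V) h : nbhs h P -> \forall k \near 0, P (h + k).
Proof.
move=> hP; have : h + k @[k --> 0] --> h + 0.
  by apply: cvgD; [exact: cvg_cst|exact: cvg_id].
by rewrite addr0; apply.
Qed.

(** Subtract the equations at [h + k] and [h], expand [quad] around [u h], and apply [g]: the error
    of the linear approximation is purely quadratic in the increment of [u]. *)
Lemma solution_increment h k g : op_inverse (dquad T b (u h)) g ->
  U h -> U (h + k) ->
  u (h + k) - u h - comp_op g K k =
  - g (2^-1 *: b (u (h + k) - u h) (u (h + k) - u h)).
Proof.
move=> [gK Kg] Uh Uhk; set d := u (h + k) - u h.
have : quad T b (u h + d) = c + K (h + k) by rewrite /d addrC subrK uE.
rewrite quadD// uE// opD (addrA c) -(addrA (c + K h)) => /addrI dE.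
by rewrite comp_opE -dE opD gK opprD addrA subrr sub0r.
Qed.

Lemma solution_is_diff h g : op_inverse (dquad T b (u h)) g -> U h ->
  is_diff h u (comp_op g K).
Proof.
move=> gP Uh; set D := comp_op g K.
apply: (@is_diff_quadratic _ _ _ _ _ (`|g| * `|b| * (2 * `|D|) ^+ 2)).
have gb0 : 0 <= `|g| * `|b| by rewrite mulr_ge0.
have inc x : `|g (2^-1 *: b x x)| <= `|g| * `|b| * `|x| * `|x| / 2.
  rewrite opZ normrZ ger0_norm// mulrC ler_wpM2r// -!mulrA op_boundW// mulrA.
  exact: op_bound2.
near=> k.
have Uhk : U (h + k).
  by near: k; apply: near_addr; apply: open_nbhs_nbhs.
have dE := solution_increment gP Uh Uhk.
(* This is where continuity of [u] enters: the increment is small enough for its quadratic term to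
   be absorbed. *)
have d1 : `|g| * `|b| * `|u (h + k) - u h| <= 1.
  rewrite (@le_trans _ _ ((`|g| * `|b| + 1) * `|u (h + k) - u h|))//.
    by rewrite ler_wpM2r// lerDl.
  rewrite -ler_pdivlMl ?ltr_wpDl// mulr1.
  near: k; apply: (@near_addr (fun y => `|u y - u h| <= _)).
  have /cvgrPdistC_le := u_cont Uh; apply.
  by rewrite invr_gt0 ltr_wpDl.
set d := u (h + k) - u h in dE d1 *.
(* With [d1] the quadratic term is at most half of [|d|]; moving it to the left bounds [d] linearly
   in [k], so the remainder is quadratic in [k]. *)
have dD : `|d| <= 2 * `|D| * `|k|.
  have : `|d| <= `|D k| + `|g (2^-1 *: b d d)|.
    by rewrite -{1}[d](subrK (D k)) dE addrC (le_trans (ler_normB _ _)).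
  have := inc d; have := op_bound D k; have := normr_ge0 d.
  by move: d1; set N := `|g| * _; nra.
rewrite dE normrN (le_trans (inc d))//.
rewrite (@le_trans _ _ (`|g| * `|b| * `|d| * `|d|))//.
  by rewrite ler_piMr ?invf_le1 ?ler1n// !mulr_ge0.
rewrite -[leLHS]mulrA -expr2 -[leRHS]mulrA -exprMn ler_wpM2l//.
by rewrite lerXn2r ?nnegrE// !mulr_ge0.
Unshelve. all: by end_near. Qed.

(** Both [Du h] and [Du h'] are mapped to [K] by the differentials at [u h] and [u h'], which differ
    by [b d]. Hence the difference [Z] is bounded by a multiple of [|d|] times [|Z| + |Du h|], and
    the term in [|Z|] is absorbed for small [d]. *)
Lemma solution_derivative_continuous (Du : V -> boundedOp V E) h g :
  op_inverse (dquad T b (u h)) g -> U h ->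
  (forall h, U h -> comp_op (dquad T b (u h)) (Du h) = K) ->
  {for h, continuous Du}.
Proof.
move=> [gK Kg] Uh DuE; apply/cvgrPdistC_le => e e0.
have gb0 : 0 <= `|g| * `|b| by rewrite mulr_ge0.
pose M := `|g| * `|b| * (1 + `|Du h|).
have M0 : 0 <= M by rewrite mulr_ge0// addr_ge0.
near=> h'.
have Uh' : U h' by near: h'; apply: open_nbhs_nbhs.
set d := u h' - u h; set Z := Du h' - Du h.
have ZE : Z = - comp_op g (comp_op (b d) Z) - comp_op g (comp_op (b d) (Du h)).
  apply/boundedOp_eqP => v.
  rewrite -[RHS]/(- g (b d (Du h' v - Du h v)) - g (b d (Du h v))).
  rewrite -opprD -opD -opD subrK -[LHS]/(Du h' v - Du h v).
  apply: (can_inj gK); rewrite opB opN Kg.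
  have Dv : dquad T b (u h) (Du h v) = dquad T b (u h') (Du h' v).
    by have /boundedOp_eqP/(_ v) : comp_op (dquad T b (u h)) (Du h) =
      comp_op (dquad T b (u h')) (Du h') by rewrite !DuE.
  rewrite Dv.
  have -> : u h' = u h + d by rewrite /d addrC subrK.
  by rewrite dquadD op_addE opprD addrA subrr sub0r.
have Zle : `|Z| <= `|g| * `|b| * `|d| * (`|Z| + `|Du h|).
  rewrite {1}ZE (le_trans (ler_normB _ _))// normrN mulrDr.
  have gbd (X : boundedOp V E) : `|comp_op g (comp_op (b d) X)| <=
      `|g| * `|b| * `|d| * `|X|.
    rewrite (le_trans (comp_op_bound _ _))// -!mulrA ler_wpM2l//.
    rewrite (le_trans (comp_op_bound _ _))// mulrA ler_wpM2r//.
    exact: op_bound.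
  by rewrite lerD.
(* The bound by 1 makes the coefficient of [|Z|] at most 1/2; the bound by [e] leaves at most
   [e / 2] for the other term. *)
have d1 : `|d| <= Num.min 1 e / (2 * (M + 1)).
  rewrite /d; near: h'; have /cvgrPdistC_le := u_cont Uh; apply.
  by rewrite divr_gt0 ?mulr_gt0 ?ltr_wpDl// lt_min ltr01.
move: d1; rewrite ler_pdivlMr ?mulr_gt0 ?ltr_wpDl// le_min => /andP[d1 de].
have := M0; move: d1 de Zle; rewrite /M.
move: (normr_ge0 Z) (normr_ge0 d) (normr_ge0 (Du h)) gb0.
set N := _ * `|b|; move: `|Z| `|d| `|Du h| N => z y w N; nra.
Unshelve. all: by end_near. Qed.

End Solution.

Theorem solution_Ck n V E F (T : boundedOp E F) b (U : set V) (u : V -> E) c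
    (K : boundedOp V F) :
  symmetric_op b -> open U ->
  (forall h, U h -> {for h, continuous u}) ->
  (forall h, U h -> quad T b (u h) = c + K h) ->
  (forall h, U h -> exists g, op_inverse (dquad T b (u h)) g) ->
  Ck n U u.
Proof.
elim: n E F T b u c K => [|n IH] E F T b u c K bs oU uc uE uinv.
  exact: uc.
(* Outside [U] the value 0 is a mere default. *)
have /choice[Du DuP] : forall h, exists D : boundedOp V E, U h ->
    exists g, op_inverse (dquad T b (u h)) g /\ D = comp_op g K.
  move=> h; have [/uinv[g gP]|nUh] := pselect (U h); last by exists 0.
  by exists (comp_op g K) => _; exists g.
have DuE h : U h -> comp_op (dquad T b (u h)) (Du h) = K.
  move=> /DuP[g [[_ Kg] ->]]; apply/boundedOp_eqP => k.
  by rewrite -[RHS]Kg.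
exists Du => [h Uh|].
  by have [g [gP ->]] := DuP h Uh; exact: (solution_is_diff bs oU uc uE gP Uh).
(* The prolonged equation has right-hand side [(c + K h, K)], affine in [h]: constant part [(c, K)],
   linear part [(K, 0)]. *)
have Ck_uDu : Ck n U (fun h => (u h, Du h)).
  apply: (IH _ _ (@prol_lin V E F T) (@prol_bilin V E F b bs) _
    (c, K) (pair_op K 0)) => //.
  - exact: prol_bilin_sym.
  - move=> h Uh; have [g [gP _]] := DuP h Uh.
    have Duc := solution_derivative_continuous oU uc gP Uh DuE.
    exact: (cvg_pair (uc h Uh) Duc).
  - move=> h Uh; rewrite prol_quadE uE// DuE//.
    by rewrite -[RHS]/(c + K h, K + 0) addr0.
  - by move=> h Uh; have [g /prol_dquad_inverse] := uinv h Uh; exact.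
exact: (Ck_comp_op (snd_op E (boundedOp V E)) Ck_uDu).
Qed.

End ImplicitSmoothness.

(** * Completeness of products *)

Section Completeness.
Context {R : realType}.
Implicit Types E F : normedModType R.

(* A predicate rather than a structure: it applies to products without
   changing the canonical structures of [E * F]. *)
Definition complete_normed E : Prop := forall A : set_system E,
  ProperFilter A -> cauchy A -> exists x : E, A --> x.

Lemma complete_normedT (E : completeNormedModType R) : complete_normed E.
Proof. by move=> A AF /cauchy_cvg/cvg_ex. Qed.

Section Packing.
Context {E : normedModType R} (cE : complete_normed E).

Lemma complete_normed_cvg (A : set_system E) :
  ProperFilter A -> cauchy A -> cvg A.
Proof. by move=> AF /cE; move/cvg_ex. Qed.

(** Turns the predicate into a structure locally, where Baire's theorem, normal convergence of
    series or the Banach fixed point theorem is invoked. *)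
Definition complete_pack : completeNormedModType R :=
  HB.pack (NormedModule.sort E)
    (Uniform_isComplete.Build E complete_normed_cvg).

End Packing.

Lemma prod_complete E F : complete_normed E -> complete_normed F ->
  complete_normed (E * F)%type.
Proof.
move=> cE cF A AF /(@cauchyP R) Ac.
have [x xP] : exists x : E, fst @ A --> x.
  apply: cE; apply/(@cauchyP R) => e e0; have [x xA] := Ac e e0.
  exists x.1; apply: (@filterS _ A _ (ball x e)) xA => y.
  rewrite -!ball_normE /= => xy.
  by apply: le_lt_trans xy; exact: (norm_fst_le (x - y)).
have [y yP] : exists y : F, snd @ A --> y.
  apply: cF; apply/(@cauchyP R) => e e0; have [y yA] := Ac e e0.
  exists y.2; apply: (@filterS _ A _ (ball y e)) yA => z.
  rewrite -!ball_normE /= => yz.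
  by apply: le_lt_trans yz; exact: (norm_snd_le (y - z)).
exists (x, y) => B /(cvg_pair xP yP).
by apply: (@filterS _ A) => -[].
Qed.

End Completeness.

(** * Banach's isomorphism theorem *)

Section OpenMapping.
Context {R : realType}.

(** The lower bound serves twice: it makes preimages unique, so a chosen inverse is linear, and it
    bounds that inverse. *)
Lemma op_inverseP (E F : normedModType R) (f : boundedOp E F) c :
  (forall x, `|x| <= c * `|f x|) -> (forall y, exists x, f x = y) ->
  exists g, op_inverse f g.
Proof.
move=> fc /choice[g gE].
have gl : linear g.
  move=> a x y; apply/eqP; rewrite -subr_eq0 -normr_le0 (le_trans (fc _))//.
  by rewrite opB opD opZ !gE subrr normr0 mulr0.
have gc y : `|g y| <= c * `|y| by rewrite -{2}[y]gE fc.
exists (mk_op gl gc); split => [x|y]; last exact: gE.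
apply/eqP; rewrite -subr_eq0 -normr_le0 (le_trans (fc _))//.
by rewrite opB [f (mk_op gl gc _)]gE subrr normr0 mulr0.
Qed.

(* Baire: some closure of the image of a ball has an interior point, and by
   midpoint convexity it contains a ball around 0. *)
Lemma surjective_almost_open (E F : normedModType R) (T : boundedOp E F) :
  complete_normed F ->
  (forall y, exists x, T x = y) ->
  exists2 c, 0 <= c &
    forall y, exists x, `|x| <= c * `|y| /\ `|y - T x| <= `|y| / 2.
Proof.
move=> cF Tsurj.
pose A (n : nat) : set F := closure (T @` [set x | `|x| <= n%:R]).
have [n [W [/set0P [y0 Wy0] [oW WA]]]] :
    exists n (W : set F), W != set0 /\ open W /\ W `<=` A n.
  (* Otherwise all complements of the [A n] are open and dense, and Baire yields a [y] outside every
     [A n], although its preimage [x] lies in the ball of radius [(Num.trunc |x|).+1]. *)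
  apply: contrapT => noW.
  have AD : forall n, open (~` A n) /\ dense (~` A n).
    move=> n; split; first exact/closed_openC/closed_closure.
    move=> W W0 oW; apply: contrapT => WA; apply: noW; exists n, W.
    split; first exact/set0P.
    split => // y Wy; apply: contrapT => nAy; apply: WA; by exists y.
  have [|y [_ yA]] := @Baire R (complete_pack cF) _ AD setT _ openT.
    by exists 0.
  have [x xy] := Tsurj y.
  apply: (yA (Num.trunc `|x|).+1) => //; apply: subset_closure; exists x => //=.
  by rewrite ltW// truncnS_gt.
have /nbhs_ballP[r /= r0 rW] : nbhs y0 W by exact: open_nbhs_nbhs.
have AE y e : A n y -> 0 < e ->
    exists2 x, `|x| <= n%:R & `|y - T x| < e.
  move=> /(_ (ball y e) (nbhsx_ballx _ _ _))Ay e0.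
  have [_ [[x /= xn <-] yx]] := Ay e0.
  by exists x => //; move: yx; rewrite -ball_normE.
have small y : `|y| < r -> forall e, 0 < e ->
    exists2 x, `|x| <= n%:R & `|y - T x| <= e.
  move=> yr e e0.
  have [||x1 x1n yx1] := AE (y0 + y) e; rewrite //.
    by apply/WA/rW; rewrite -ball_normE /= opprD addrA subrr sub0r normrN.
  have [||x2 x2n yx2] := AE (y0 - y) e; rewrite //.
    by apply/WA/rW; rewrite -ball_normE /= opprB addrCA subrr addr0.
  (* [y] is half the difference of [y0 + y] and [y0 - y], both within reach of the image of the
     ball. *)
  exists (2^-1 *: (x1 - x2)).
    rewrite normrZ ger0_norm// ler_pdivrMl// (le_trans (ler_normB _ _))//.
    by rewrite mulr_natl mulr2n lerD.
  have -> : y - T (2^-1 *: (x1 - x2)) =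
      2^-1 *: ((y0 + y - T x1) - (y0 - y - T x2)).
    have y2 : y = 2^-1 *: (y + y).
      by rewrite -mulr2n -(scaler_nat 2 y) scalerA mulVf ?scale1r.
    rewrite opZ opB {1}y2 -scalerBr; congr (_ *: _).
    rewrite (opprD (y0 - y)) opprK [RHS]addrACA (opprB y0) (addrC y0).
    by rewrite (addrACA y) subrr addr0 opprD opprK.
  rewrite normrZ ger0_norm// ler_pdivrMl// (le_trans (ler_normB _ _))//.
  by rewrite mulr_natl mulr2n lerD// ltW.
exists (2 * n%:R / r); first by rewrite divr_ge0 ?mulr_ge0 ?(ltW r0).
move=> y; have [->|y_neq0] := eqVneq y 0.
  by exists 0; rewrite op0 subr0 !normr0 mulr0 mul0r.
have ny : 0 < `|y| by rewrite normr_gt0.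
(* Dividing by [a] brings [y] to norm [r / 2]; scaling back turns the tolerance [r / 4] into
   [|y| / 2] and the radius [n] into [2 * n / r * |y|]. *)
pose a := 2 * `|y| / r.
have a0 : 0 < a by rewrite divr_gt0// mulr_gt0.
have yr : `|a^-1 *: y| < r.
  rewrite normrZ gtr0_norm ?invr_gt0// /a.
  have -> : (2 * `|y| / r)^-1 * `|y| = r / 2 by field; rewrite !gt_eqF.
  by rewrite gtr_pMr// invf_lt1// ltr1n.
have r4 : 0 < r / 4 by rewrite divr_gt0.
have [x xn yx] := small _ yr _ r4.
exists (a *: x); split.
  rewrite normrZ gtr0_norm// (le_trans (ler_wpM2l (ltW a0) xn))//.
  by rewrite /a le_eqVlt; apply/orP; left; apply/eqP; ring.
have -> : y - T (a *: x) = a *: (a^-1 *: y - T x).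
  by rewrite opZ scalerBr scalerA mulfV ?gt_eqF// scale1r.
rewrite normrZ gtr0_norm// (le_trans (ler_wpM2l (ltW a0) yx))//.
rewrite /a le_eqVlt; apply/orP; left; apply/eqP; field.
by rewrite gt_eqF.
Qed.

(** Solve approximately, then correct the residual, repeatedly. Residuals halve at each stage, so
    the corrections form a geometrically dominated series whose sum is an exact preimage of
    controlled norm. *)
Theorem banach_isomorphism (E F : normedModType R) (T : boundedOp E F) :
  complete_normed E -> complete_normed F ->
  injective T -> (forall y, exists x, T x = y) -> exists g, op_inverse T g.
Proof.
move=> cE cF Tinj Tsurj.
have [c c0 /choice[s sP]] := surjective_almost_open cF Tsurj.
suff bound y : exists x, T x = y /\ `|x| <= 2 * c * `|y|.
  apply: (@op_inverseP _ _ _ (2 * c)) => // x.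
  by have [x' [/Tinj <-]] := bound (T x).
pose res := fix res n := if n is m.+1 then res m - T (s (res m)) else y.
have resle n : `|res n| <= `|y| * 2^-1 ^+ n.
  elim: n => [|n IH] /=; first by rewrite expr0 mulr1.
  rewrite exprSr mulrA (le_trans (sP _).2)// ler_wpM2r//.
pose u n := s (res n).
have ule n : `|u n| <= geometric (c * `|y|) 2^-1 n.
  rewrite /= -mulrA (le_trans (sP _).1)// ler_wpM2l//.
have half : `|2^-1| < 1 :> R by rewrite ger0_norm// invf_lt1// ltr1n.
have ucvg : cvgn (series u).
  apply: (@normed_cvg _ (complete_pack cE)).
  apply: (series_le_cvg _ _ ule) => [n|n|].
  - exact: normr_ge0.
  - by rewrite /= mulr_ge0// mulr_ge0.
  - exact: is_cvg_geometric_series.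
have Tser n : T (series u n) = y - res n.
  elim: n => [|n IH]; first by rewrite seriesEnat/= big_geq// op0 subrr.
  by rewrite seriesSr opD IH /= opprB addrA [RHS]addrAC.
have serle n : `|series u n| <= 2 * c * `|y|.
  (* The induction needs the exact geometric partial sum; the uniform bound does not reproduce
     itself. *)
  apply: (@le_trans _ _ (2 * c * `|y| * (1 - 2^-1 ^+ n))); last first.
    by rewrite ler_piMr ?mulr_ge0// gerBl exprn_ge0.
  elim: n => [|n IH].
    by rewrite seriesEnat/= big_geq// normr0 expr0 subrr mulr0.
  rewrite seriesSr (le_trans (ler_normD _ _))// (le_trans (lerD IH (ule n)))//.
  by rewrite /= exprS le_eqVlt; apply/orP; left; apply/eqP; field.
exists (limn (series u)); split; last first.
  apply: (cvgr_to_le (cvg_norm ucvg)).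
  by apply: nearW => n; exact: serle.
have Tc : T \o series u @ \oo --> T (limn (series u)).
  by apply: continuous_cvg; [exact: boundedOp_continuous|exact: ucvg].
apply: (cvg_unique _ Tc) => //; rewrite [T \o _](funext Tser).
rewrite /= -[X in _ --> X]subr0; apply: cvgB; first exact: cvg_cst.
apply: norm_cvg0; apply: (squeeze_cvgr _ (cvg_cst 0) (cvg_geometric `|y| half)).
by apply: nearW => n; rewrite normr_ge0 resle.
Qed.

End OpenMapping.

(** * Local inversion of quadratic maps by contraction *)

Section LocalInversion.
Context {R : realType}.

Lemma half_contraction_fixpoint (E : normedModType R) (A : set E) (f : E -> E) :
  complete_normed E -> closed A -> A !=set0 -> (forall x, A x -> A (f x)) ->
  (forall x y, A x -> A y -> `|f x - f y| <= `|x - y| / 2) ->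
  exists2 p, A p & p = f p.
Proof.
move=> cE cA A0 fA f2.
pose ff : {fun A >-> A} := HB.pack f (isFun.Build _ _ A A f fA).
apply: (@banach_fixed_point R (complete_pack cE) A ff) => //.
exists (2^-1%:nng); split; first by rewrite /= invf_lt1// ltr1n.
by move=> [x y] [/= Ax Ay]; rewrite mulrC; exact: f2.
Qed.

(** Since [g o h] has norm at most 1/2, it is absorbed in the lower bound for [f + h], and
    [(f + h) x = y] is the fixed point equation of the contraction [x |-> g (y - h x)]. *)
Lemma op_inverse_perturb (E F : normedModType R) (f h : boundedOp E F)
    (g : boundedOp F E) :
  complete_normed E ->
  op_inverse f g -> `|g| * `|h| <= 2^-1 ->
  exists g', op_inverse (f + h) g'.
Proof.
move=> cE [gK Kg] gh; have ghx x : `|g (h x)| <= `|x| / 2.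
  rewrite mulrC (le_trans (op_boundW _ (op_bound _ _)))// mulrA.
  by rewrite ler_wpM2r.
apply: (@op_inverseP _ _ _ _ (2 * `|g|)) => [x|y].
  have : `|x| <= `|g ((f + h) x)| + `|g (h x)|.
    by rewrite opD gK (le_trans _ (ler_normB _ _))// addrK.
  have := ghx x; have := op_bound g ((f + h) x); lra.
have [||||x y' _ _|x _ xE] :=
    @half_contraction_fixpoint E setT (fun x => g (y - h x)).
- exact: cE.
- exact: closedT.
- by exists 0.
- by [].
- by rewrite -opB opprB [X in g X]addrC addrA subrK -opB distrC ghx.
exists x; rewrite op_addE {1}xE Kg subrK//.
Qed.

(** Newton's method with the derivative frozen at [x0]. The contraction estimate gives both the
    Lipschitz bound of the inverse and the existence of preimages; nearby differentials are small
    perturbations of the one at [x0]. *)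
Theorem quad_local_inversion (E F : normedModType R) (T : boundedOp E F)
    b x0 g :
  complete_normed E -> symmetric_op b -> op_inverse (dquad T b x0) g ->
  exists r rho c, [/\ 0 < r, 0 < rho,
    forall x, `|x - x0| < r -> exists g', op_inverse (dquad T b x) g',
    forall x y, `|x - x0| < r -> `|y - x0| < r ->
      `|x - y| <= c * `|quad T b x - quad T b y| &
    forall y, `|y - quad T b x0| < rho ->
      exists2 x, `|x - x0| < r & quad T b x = y].
Proof.
move=> cE bs [gK Kg].
(* With [N * r <= 1/4], the displacement of the base point and the quadratic term each contribute at
   most 1/4 to the contraction ratio 1/2. *)
pose N := `|g| * `|b|; pose r := (4 * (N + 1))^-1.
have N0 : 0 <= N by rewrite mulr_ge0.
have r0 : 0 < r by rewrite invr_gt0 mulr_gt0// ltr_wpDl.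
have Nr : N * r <= 4^-1.
  rewrite /r invfM mulrCA ler_piMr// ler_pdivrMr ?ltr_wpDl// mul1r lerDl//.
have gb x y : `|g (b x y)| <= N * `|x| * `|y|.
  by rewrite (le_trans (op_boundW _ (op_bound2 _ _ _)))// !mulrA.
(* The map [x |-> x - g (quad x)] is a contraction near [x0]. *)
have contr x y : `|x - x0| < r -> `|y - x0| < r ->
    `|(x - y) - g (quad T b x - quad T b y)| <= `|x - y| / 2.
  move=> xr yr; set w := x - y.
  have -> : x = y + w by rewrite /w addrC subrK.
  have wE : quad T b (y + w) - quad T b y =
      dquad T b x0 w + (b (y - x0) w + 2^-1 *: b w w).
    rewrite quadD// -(addrA (quad T b y)) addrAC subrr add0r.
    rewrite -{1}(subrK x0 y) (addrC _ x0).
    by rewrite dquadD op_addE addrA.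
  rewrite wE opD gK opprD addrA subrr sub0r normrN opD opZ.
  rewrite (le_trans (ler_normD _ _))// normrZ ger0_norm//.
  have wr : `|w| <= 2 * r.
    have -> : w = (x - x0) - (y - x0) by rewrite opprB addrA subrK.
    by rewrite (le_trans (ler_normB _ _))// mulr_natl mulr2n lerD// ltW.
  have := gb (y - x0) w; have := gb w w; move: yr wr Nr N0 (normr_ge0 w).
  move: `|y - x0| `|w| `|g _| `|g _| => d z a a' dr zr Nr N0 z0 aE aE'.
  have : N * d * z <= 4^-1 * z.
    by rewrite ler_wpM2r// (le_trans _ Nr)// ler_wpM2l// ltW.
  have : N * z * z <= 2^-1 * z.
    rewrite ler_wpM2r// (le_trans (ler_wpM2l N0 zr))// mulrCA; lra.
  lra.
have dinv x : `|x - x0| < r -> exists g', op_inverse (dquad T b x) g'.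
  move=> xr; have -> : x = x0 + (x - x0) by rewrite addrC subrK.
  rewrite dquadD; apply: (@op_inverse_perturb _ _ _ _ g) => //.
  have : `|g| * `|b (x - x0)| <= N * r.
    by rewrite /N -mulrA ler_wpM2l// op_boundW// ltW.
  lra.
(* This [rho] keeps the first Newton step from [x0] within [r / 4], so the closed ball of radius
   [r / 2] is mapped into itself. The constant [2 * |g|] results from absorbing the ratio 1/2. *)
exists r, (r / (4 * (`|g| + 1))), (2 * `|g|); split => //.
- by rewrite divr_gt0// mulr_gt0// ltr_wpDl.
- move=> x y xr yr; have := contr x y xr yr.
  have := op_bound g (quad T b x - quad T b y).
  set k := g _ => kle kc; have : `|x - y| <= `|x - y - k| + `|k|.
    by rewrite (le_trans _ (ler_normD _ _))// subrK.
  lra.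
- move=> y yrho.
  have r2 : 0 < r / 2 by rewrite divr_gt0.
  have AE : closed_ball x0 (r / 2) = [set x | `|x - x0| <= r / 2].
    by rewrite closed_ballE//; apply/seteqP; split => x /=; rewrite distrC.
  have Ar x : `|x - x0| <= r / 2 -> `|x - x0| < r by move=> xA; lra.
  (* Its fixed points are the solutions of [quad T b x = y], because [g] is injective. *)
  pose f x := x - g (quad T b x - y).
  have fB x x' : f x - f x' = (x - x') - g (quad T b x - quad T b x').
    rewrite /f opprD addrACA -opprD -opB; congr (_ - g _).
    by rewrite opprB addrA subrK.
  have [|||x|x x'|x xA xE] :=
      @half_contraction_fixpoint E [set x | `|x - x0| <= r / 2] f.
  + exact: cE.
  + by rewrite -AE; exact: closed_ball_closed.
  + by exists x0 => /=; rewrite subrr normr0 ltW.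
  + move=> /= xA; have -> : f x - x0 = (f x - f x0) + (f x0 - x0).
      by rewrite addrA subrK.
    rewrite (le_trans (ler_normD _ _))// fB.
    have := contr x x0 (Ar _ xA); rewrite subrr normr0 => /(_ r0).
    have : `|f x0 - x0| <= r / 4.
      rewrite /f addrAC subrr sub0r normrN (le_trans (op_bound _ _))// distrC.
      move: yrho; rewrite invfM mulrA ltr_pdivlMr ?ltr_wpDl// => yrho.
      rewrite (le_trans _ (ltW yrho))// mulrC ler_wpM2l// lerDl//.
    by move: xA; set z := `|x - x0|; lra.
  + by move=> xA xA'; rewrite fB; apply: contr; exact: Ar.
  exists x; first exact: Ar.
  apply/eqP; rewrite -subr_eq0; apply/eqP/(can_inj Kg); rewrite op0.
  by apply/eqP; rewrite -oppr_eq0 -(inj_eq (addrI x)) addr0 -[x - _]/(f x) -xE.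
Qed.

End LocalInversion.

(** * The inner product as a bounded bilinear form *)

Section InnerProduct.
Context {R : realType} {V : hilbertType R}.
Implicit Types x y z : V.

Lemma inner_linl y : linear (fun x : V => inner x y : R).
Proof. by move=> a x z; rewrite linearPl. Qed.

Lemma inner_sym x y : inner x y = inner y x.
Proof. by rewrite hermC expr0 mul1r. Qed.

Lemma inner_linr x : linear (fun y : V => inner x y : R).
Proof. by move=> a y z; rewrite !(inner_sym x) inner_linl. Qed.

Lemma innerPr x a y z : inner x (a *: y + z) = a * inner x y + inner x z :> R.
Proof. exact: inner_linr. Qed.

(* Polarization gives the (non-sharp) constant 2. *)
Lemma inner_bound x y : `|inner x y : R| <= 2 * `|x| * `|y|.
Proof.
have e4 : `|x + y| ^+ 2 - `|x - y| ^+ 2 = 4 * inner x y.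
  have iDl u v w : inner (u + v) w = inner u w + inner v w :> R.
    exact: linearDl.
  have iNl u w : inner (- u) w = - inner u w :> R by exact: linearNl.
  rewrite !sqr_normE !iDl !iNl !(inner_sym _ (x + y)) !(inner_sym _ (x - y)).
  by rewrite !iDl !iNl (inner_sym y x); ring.
(* By [e4], the inner product is a quarter of [(|x + y| - |x - y|) * (|x + y| + |x - y|)]. The first
   factor is bounded by both [2 * |x|] and [2 * |y|]; pairing each bound with the opposite term of
   the second factor leaves only products [|x| * |y|]. *)
have le1 : `| `|x + y| - `|x - y| | <= 2 * `|x|.
  rewrite -[X in _ - X]normrN (le_trans (ler_dist_dist _ _))//.
  by rewrite opprK addrACA subrr addr0 mulr_natl mulr2n ler_normD.
have le2 : `| `|x + y| - `|x - y| | <= 2 * `|y|.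
  rewrite (le_trans (ler_dist_dist _ _))// opprB addrC addrA subrK.
  by rewrite mulr_natl mulr2n ler_normD.
have := ler_normD x y; have := ler_normB x y.
have -> : inner x y =
    4^-1 * ((`|x + y| - `|x - y|) * (`|x + y| + `|x - y|)) :> R.
  by apply: (@mulfI _ 4) => //; rewrite -e4; field.
rewrite normrM [X in X * _]ger0_norm// ler_pdivrMl// normrM.
rewrite [X in _ * X <= _]ger0_norm ?addr_ge0//.
move: le1 le2 (normr_ge0 (x - y)) (normr_ge0 (x + y)).
move: (normr_ge0 x) (normr_ge0 y).
set d := `| _ - _ |; set m := `|x + y|; set p := `|x - y|.
set u := `|x|; set v := `|y| => u0 v0 du dv p0 m0 pu mu.
have d0 : 0 <= d by exact: normr_ge0.
have : d * (m + p) <= d * (2 * u + 2 * v) by rewrite ler_wpM2l//; lra.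
have : d * u <= 2 * v * u by rewrite ler_wpM2r.
have : d * v <= 2 * u * v by rewrite ler_wpM2r.
lra.
Qed.

End InnerProduct.

(** * The augmented map [Phi] and its differential at a simple solution *)

Section MainMap.
Context {R : realType} {G H : hilbertType R}.
Variables (L C : boundedOp G H).

Local Notation E := (G * R)%type.
Local Notation F := (H * R)%type.

Definition aug_lin : boundedOp E F := pair_op (comp_op L (fst_op G R)) 0.

(** Polar form of the quadratic part [(- l C x, |x|^2)] of [Phi], doubled to offset the 1/2 in
    [quad]. *)
Definition aug_fun (p q : E) : F :=
  (- (p.2 *: C q.1 + q.2 *: C p.1), 2 * inner p.1 q.1).

Lemma aug_fun_sym p q : aug_fun p q = aug_fun q p.
Proof. by rewrite /aug_fun inner_sym [X in - X]addrC. Qed.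

Lemma aug_fun_linr p : linear (aug_fun p).
Proof.
move=> a q q'; apply/pair_equal_spec; split => /=; last first.
  by rewrite inner_linr mulrDr mulrCA.
rewrite opD opZ scalerDl scalerN -opprD; congr (- _).
by rewrite !scalerDr !scalerA [p.2 * a]mulrC addrACA.
Qed.

Lemma aug_fun_linl q : linear (aug_fun ^~ q).
Proof. by move=> a p p'; rewrite !(aug_fun_sym _ q) -aug_fun_linr. Qed.

Lemma aug_fun_bound p q : `|aug_fun p q| <= (2 * `|C| + 4) * `|p| * `|q|.
Proof.
have Cbound (x : G) (a s t : R) : `|a| <= s -> `|x| <= t ->
    `|a *: C x| <= `|C| * s * t.
  by move=> sa tx; rewrite normrZ mulrAC mulrC ler_pM ?op_boundW.
have pq0 : 0 <= `|p| * `|q| by rewrite mulr_ge0.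
have Cpq0 : 0 <= `|C| * `|p| * `|q| by rewrite !mulr_ge0.
apply/le_norm_prod; split => /=.
  rewrite normrN (le_trans (ler_normD _ _))//.
  have := Cbound _ _ _ _ (norm_snd_le p) (norm_fst_le q).
  have := Cbound _ _ _ _ (norm_snd_le q) (norm_fst_le p).
  lra.
rewrite normrM ger0_norm//.
have : `|inner p.1 q.1 : R| <= 2 * (`|p| * `|q|).
  rewrite (le_trans (inner_bound _ _))// -mulrA ler_wpM2l//.
  by rewrite ler_pM ?norm_fst_le.
lra.
Qed.

Lemma aug_bound_ge0 : 0 <= 2 * `|C| + 4.
Proof. by rewrite addr_ge0// mulr_ge0. Qed.

Definition aug_bilin : boundedOp E (boundedOp E F) :=
  bilin_op aug_fun_linl aug_fun_linr aug_fun_bound aug_bound_ge0.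

Lemma aug_sym : symmetric_op aug_bilin.
Proof. exact: aug_fun_sym. Qed.

Lemma aug_quadE p : quad aug_lin aug_bilin p = (Psi L C p, `|p.1| ^+ 2).
Proof.
apply/pair_equal_spec; split => /=.
  rewrite -[LHS]/(L p.1 + 2^-1 *: - (p.2 *: C p.1 + p.2 *: C p.1)).
  rewrite scalerN /Psi; congr (_ - _).
  exact: scale_half_double.
rewrite -[LHS]/(0 + 2^-1 * (2 * inner p.1 p.1)).
by rewrite sqr_normE add0r mulrA mulVf ?mul1r.
Qed.

Lemma aug_dquadE p q : dquad aug_lin aug_bilin p q =
  (L q.1 - p.2 *: C q.1 - q.2 *: C p.1, 2 * inner p.1 q.1).
Proof.
apply/pair_equal_spec; split => /=.
  by rewrite -[LHS]/(L q.1 - (p.2 *: C q.1 + q.2 *: C p.1)) opprD addrA.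
by rewrite -[LHS]/(0 + 2 * inner p.1 q.1) add0r.
Qed.

Lemma Psi_Ck n U : Ck n U (Psi L C).
Proof.
have -> : Psi L C = fst_op H R \o (fun p => 0 + quad aug_lin aug_bilin p).
  apply/funext => p; rewrite -[RHS]/((0 + quad aug_lin aug_bilin p).1).
  by rewrite add0r aug_quadE.
by apply: Ck_comp_op; apply: quad_Ck; exact: aug_sym.
Qed.

Lemma Psi_continuous : continuous (Psi L C).
Proof. by move=> p; exact: (@Psi_Ck 0 setT). Qed.

Lemma aug_complete (V : hilbertType R) : complete_normed (V * R)%type.
Proof. by apply: prod_complete; exact: complete_normedT. Qed.

(** With [A = L - l *: C] the differential is [(w, m) |-> (A w - m C xs, 2 <xs, w>)]. If it
    vanishes, directness of the sum gives [A w = 0] and [m = 0], so [w] is a multiple of [xs],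
    killed by the second component. Surjectivity uses that the sum is all of [H]. *)
Lemma aug_dquad_inverse xs l : simple_solution L C xs l ->
  exists g, op_inverse (dquad aug_lin aug_bilin (xs, l)) g.
Proof.
move=> [[xs1 Lxs] kerA Cxs0 [disj sumH]].
have inner_xs : inner xs xs = 1 :> R by rewrite -sqr_normE xs1 expr1n.
have kerxs a : op_ker (L - l *: C) (a *: xs) by rewrite kerA; exists a.
have opAE w : (L - l *: C) w = L w - l *: C w by [].
apply: banach_isomorphism; first exact: aug_complete.
- exact: aug_complete.
- suff ker0 q : dquad aug_lin aug_bilin (xs, l) q = 0 -> q = 0.
    move=> q q' qq'; apply/eqP; rewrite -subr_eq0; apply/eqP/ker0.
    by rewrite opB qq' subrr.
  rewrite aug_dquadE => /pair_equal_spec[/= /eqP].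
  rewrite subr_eq0 => /eqP Aq qi.
  have q2 : q.2 *: C xs = 0.
    have : (range (L - l *: C) `&` C @` op_ker (L - l *: C)) (q.2 *: C xs).
      split; first by exists q.1.
      by exists (q.2 *: xs) => //; rewrite opZ.
    by rewrite disj.
  have : op_ker (L - l *: C) q.1 by apply: etrans q2; rewrite -Aq.
  rewrite kerA => -[a _ aq].
  have a0 : a = 0.
    have : inner xs (a *: xs) = a * inner xs xs :> R.
      by rewrite -[a *: xs]addr0 innerPr (inner_sym _ 0) linear0l addr0.
    by rewrite aq inner_xs mulr1 => <-; apply: (@mulfI _ 2); rewrite ?mulr0.
  rewrite (surjective_pairing q) -aq a0 scale0r.
  by move/eqP: q2; rewrite scaler_eq0 (negbTE Cxs0) orbF => /eqP ->.
move=> [h s].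
have : [set v + w | v in range (L - l *: C) & w in C @` op_ker (L - l *: C)] h.
  by rewrite sumH.
move=> [_ [v _ <-] [_ [k kk <-] <-]]; move: kk; rewrite kerA => -[c _ <-].
(* Adding a multiple of [xs], which lies in the kernel, leaves the first component unchanged and
   tunes the second to [s]. *)
exists (v + (s / 2 - inner xs v) *: xs, - c).
rewrite aug_dquadE /=; apply/pair_equal_spec; split.
  rewrite scaleNr opprK opZ; congr (_ + _).
  by rewrite -opAE opD (kerxs _) addr0.
by rewrite addrC innerPr inner_xs mulr1 subrK mulrC divfK.
Qed.

End MainMap.

(** * The local inverse of [Psi] on the sphere *)

Theorem lemma3p2 (R : realType) (G H : hilbertType R) (L C : boundedOp G H)
    (xs : G) (lambdas : R) :
  simple_solution L C xs lambdas ->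
  exists (U : set (G * R)) (W : set H),
    [/\ open U, U (xs, lambdas), open W, W 0 &
        diffeomorphism (U `&` (@unit_sphere R G `*` [set: R])) W (Psi L C)].
Proof.
move=> simple; have [[xs1 Lxs] _ _ _] := simple.
have [g0 g0P] := aug_dquad_inverse simple.
have [r [rho [c [r0 rho0 inv inj surj]]]] :=
  quad_local_inversion (@aug_complete R G) (aug_sym C) g0P.
set p0 : (G * R)%type := (xs, lambdas) in inv inj surj *.
have Psi0 : Psi L C p0 = 0 by rewrite /Psi /= Lxs subrr.
have quad0E : quad (aug_lin L) (aug_bilin C) p0 = (0, 1).
  by rewrite aug_quadE Psi0 /= xs1 expr1n.
pose W : set H := ball 0 rho.
have WE h : W h <-> `|h| < rho by rewrite /W -ball_normE /= sub0r normrN.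
have oW : open W by exact: ball_open.
(* [g h] is the preimage of [(h, 1)] under [Phi], available because [(h, 1)] is at distance [|h|]
   from [Phi p0 = (0, 1)]; off [W] the value [p0] is a default. *)
have /choice[g gP] : forall h : H, exists p : (G * R)%type, W h ->
    `|p - p0| < r /\ quad (aug_lin L) (aug_bilin C) p = (h, 1).
  move=> h; have [/WE Wh|] := pselect (W h); last by exists p0.
  have [|p pr pE] := surj (h, 1); last by exists p.
  rewrite quad0E -[(h, 1) - (0, 1)]/(h - 0, 1 - 1) !subrr subr0.
  by rewrite prod_normE /= normr0 gt_max Wh.
have sphere1 (p : G * R) : unit_sphere p.1 ->
    quad (aug_lin L) (aug_bilin C) p = (Psi L C p, 1).
  by move=> p1; rewrite aug_quadE p1 expr1n.
have gsphere h : W h -> Psi L C (g h) = h /\ unit_sphere (g h).1.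
  move=> /gP[_]; rewrite aug_quadE => -[-> /eqP].
  by rewrite sqrp_eq1// => /eqP.
(* Intersecting with the preimage of [W] makes [Psi] map the neighborhood into [W], with image all
   of [W] on the sphere. *)
pose U : set (G * R)%type := ball p0 r `&` Psi L C @^-1` W.
have UE p : U p <-> `|p - p0| < r /\ W (Psi L C p).
  by rewrite /U -ball_normE /= distrC.
have inj' p q : U p -> U q -> unit_sphere p.1 -> unit_sphere q.1 ->
    Psi L C p = Psi L C q -> p = q.
  move=> /UE[pr _] /UE[qr _] p1 q1 pq; apply/eqP.
  rewrite -subr_eq0 -normr_le0 (le_trans (inj _ _ pr qr))//.
  by rewrite !sphere1// pq subrr normr0 mulr0.
have gU h : W h -> U (g h).
  move=> Wh; apply/UE; rewrite (gsphere h Wh).1; split => //.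
  by have [] := gP h Wh.
exists U, W; split.
- apply: openI; first exact: ball_open.
  by apply: open_comp => // p _; exact: Psi_continuous.
- by apply/UE; rewrite subrr normr0 Psi0 WE normr0.
- exact: oW.
- by apply/WE; rewrite normr0.
split.
- split.
  + by move=> p [/UE[]].
  + move=> p q /set_mem[Up [p1 _]] /set_mem[Uq [q1 _]]; exact: inj'.
  + move=> h Wh; exists (g h); last by have [] := gsphere h Wh.
    by split; [exact: gU|split => //; have [] := gsphere h Wh].
- move=> p _; exists setT, (Psi L C); split => //; first exact: openT.
  by move=> n; exact: Psi_Ck.
exists g.
  move=> p /set_mem[Up [p1 _]]; have [_ Wp] := (UE p).1 Up.
  have [gE g1] := gsphere _ Wp.
  by apply: inj' => //; exact: gU.
(* Continuity comes from the Lipschitz bound [inj]; [|c| + 1] is used since the sign of [c] is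
   unknown. *)
have g_cont h : W h -> {for h, continuous g}.
  move=> Wh; apply/cvgrPdistC_le => e e0.
  have c1 : 0 < `|c| + 1 by rewrite ltr_wpDl.
  near=> h'.
  have Wh' : W h' by near: h'; apply: open_nbhs_nbhs.
  have [hr hE] := gP h Wh; have [hr' hE'] := gP h' Wh'.
  rewrite (le_trans (inj _ _ hr' hr))// hE hE'.
  rewrite -[(h', 1) - (h, 1)]/(h' - h, 1 - 1) subrr prod_normE /= normr0.
  rewrite max_l// (@le_trans _ _ ((`|c| + 1) * `|h' - h|))//.
    by rewrite ler_wpM2r// (le_trans (ler_norm c))// lerDl.
  rewrite -ler_pdivlMl//; near: h'; apply: cvgr_distC_le => //.
  by rewrite mulr_gt0// invr_gt0.
(* [W] is open in [H], so [g] serves as its own smooth extension; it solves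
   [Phi (g k) = (0, 1) + (k, 0)], to which [solution_Ck] applies. *)
move=> h Wh; exists W, g; split => // n.
have idb (x : H) : `|idfun x| <= 1 * `|x| by rewrite mul1r.
pose idop : boundedOp H H := @mk_op R H H idfun 1 (fun _ _ _ => erefl) idb.
apply: (@solution_Ck R n H (G * R)%type (H * R)%type (aug_lin L) (aug_bilin C)
  W g (0, 1) (pair_op idop 0) (aug_sym C) oW g_cont).
- move=> k Wk; have [_ ->] := gP k Wk.
  by rewrite -[RHS]/(0 + k, 1 + 0) add0r addr0.
- by move=> k Wk; apply: inv; have [] := gP k Wk.
Unshelve. all: by end_near. Qed.
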